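(* Let $S$ be a discrete subset of $\mathbb{R}^d$ and let $k$ be an integer such that the $k$-quantitative Helly number $\mathbb{H}_S(k)$ is finite. Let $p \ge q \ge \mathbb{H}_S(k)$ be positive integers. Then there is a constant $c = c(p,q,k,S)$ such that the following is true. For any finite family $\mathcal{F}$ of convex sets in $\mathbb{R}^d$, each containing at least $k$ points of $S$, and such that among every $p$ sets in $\mathcal{F}$ there are $q$ whose intersection contains $k$ points of $S$, we can find $c$ sets $K_1, K_2, \ldots, K_c$, each containing $k$ points of $S$, such that every $F \in \mathcal{F}$ contains at least one $K_i$ (that is, $K_i \subset F$ for some $i$).
   Context: A set $S \subset \mathbb{R}^d$ is discrete if every point $x \in \mathbb{R}^d$ has a neighborhood that contains no point of $S$ other than possibly $x$ itself. For a discrete set $S \subset \mathbb{R}^d$, the $k$-quantitative Helly number $\mathbb{H}_S(k)$ is the smallest number for which the following holds: for any finite family $\mathcal{F}$ of convex sets in $\mathbb{R}^d$ such that for every subfamily $\mathcal{F}'$ of cardinality $\mathbb{H}_S(k)$ or less the intersection $\bigcap \mathcal{F}'$ has at least $k$ points of $S$, the intersection $\bigcap \mathcal{F}$ contains at least $k$ points of $S$. If no such number exists, $\mathbb{H}_S(k) = \infty$. *)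

(* Defs.v *)
From HB Require Import structures.
From mathcomp Require Import all_boot all_order all_algebra finmap.
From mathcomp Require Import all_classical all_reals all_analysis.
Import numFieldNormedType.Exports.

Set Implicit Arguments.
Unset Strict Implicit.
Unset Printing Implicit Defensive.

Local Open Scope fset_scope.
Local Open Scope classical_set_scope.
Local Open Scope ring_scope.

(* Every point of the ambient space, not only those of S, is tested: S has no
   accumulation point, so S is also closed. *)
Definition discrete_subset (T : topologicalType) (S : set T) : Prop :=
  forall x : T, exists2 U : set T, nbhs x U & U `&` S `<=` [set x].

(* card_le is meaningful for infinite sets too. *)
Definition has_points (T : Type) (S : set T) (k : nat) (A : set T) : Prop :=
  (`I_k #<= A `&` S)%card.

(* The intersection of the empty family is the whole space. *)
Definition fam_inter (T : Type) (F : {fset set T}) : set T :=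
  \bigcap_(A in [set` F]) A.

Definition convex_family (R : realType) (d : nat)
    (F : {fset set 'rV[R]_d}) : Prop :=
  forall A : set 'rV[R]_d, A \in F -> @convex_set R 'rV[R]_d A.

Definition helly_property (R : realType) (d : nat) (S : set 'rV[R]_d)
    (k h : nat) : Prop :=
  forall F : {fset set 'rV[R]_d}, convex_family F ->
    (forall G : {fset set 'rV[R]_d},
        (G `<=` F)%fset -> (#|` G| <= h)%N -> has_points S k (fam_inter G)) ->
    has_points S k (fam_inter F).

(* H_S(k) = h; the case H_S(k) = oo is that no h satisfies this. *)
Definition is_quantitative_helly_number (R : realType) (d : nat)
    (S : set 'rV[R]_d) (k h : nat) : Prop :=
  helly_property S k h /\
  forall h' : nat, helly_property S k h' -> (h <= h')%N.

(* Main.v *)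
Require Import Defs.
From HB Require Import structures.
From mathcomp Require Import all_boot all_order all_algebra finmap.
From mathcomp Require Import zify ring lra.
From mathcomp Require Import all_classical all_reals all_analysis.
Import numFieldNormedType.Exports.

(** A bounded piece of [S] is finite, because [S] is discrete, and its points
    can be listed so that each initial segment is cut out of [S] by a convex
    set.  Among all the points of [S] in an intersection of convex sets, single
    out the first [k] in this list.  If a convex set that cuts off the list just
    before the [k]-th of these points is added to the family, the intersection
    loses a point and has only [k - 1] left; Helly's property says that at most
    [h - 1] members of the family are responsible.  Hence the first [k] points
    of an intersection of [h] convex sets are already the first [k] points of
    the intersection of some [h - 1] of them ([first_points_determined]).

    Counting turns this into a colourful fractional Helly theorem
    ([block_selection]): when the [h] sets depend on disjoint blocks of
    coordinates of a tuple, and a positive fraction of all tuples give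
    intersections with [k] points, freeze all the blocks but the omitted one; a
    positive fraction of the values of that block give sets with a common
    [k]-point set.  It is used three times.
    - Applied to tuples of members of the family, it says that some [k]-point
      set lies in a positive fraction of the members, for every weighting of
      the family ([fractional_helly]).  Multiplicative weights then produce a
      list of [k]-point sets such that every member contains a positive
      fraction of the list ([multiplicative_weights]).
    - Applied to the parallel slabs of a grid of side [h * h] in dimension [h],
      where slabs in different directions always meet, it gives [h] disjoint
      slabs with intersecting hulls, a Tverberg type theorem valid in every
      convexity with the above property ([slab_tverberg]).
    - Applied to tuples indexed by this grid, it says that some [k]-point set
      lies in the hulls of a positive fraction of all tuples of a list of
      [k]-point sets ([popular_hull_points]), which yields weak nets by the
      greedy algorithm ([weak_net]).
    A weak net of the list produced by the weights is the wanted piercing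
    family.  Everything but the listing of [S] is carried out for an arbitrary
    notion of convexity. *)

Set Implicit Arguments.
Unset Strict Implicit.
Unset Printing Implicit Defensive.

Local Open Scope fset_scope.
Local Open Scope classical_set_scope.
Local Open Scope ring_scope.

(** * Counting tuples *)

Section Counting.
Local Open Scope nat_scope.

Lemma large_fiber (X B : finType) (E : {set X}) (f : X -> B) :
  0 < #|E| -> exists b, #|E| <= #|B| * #|[set x in E | f x == b]|%SET.
Proof.
move=> /card_gt0P[x0 _].
apply: contrapT => /forallNP no.
have : #|E| = \sum_(b : B) #|[set x in E | f x == b]|%SET.
  rewrite -sum1_card (partition_big f predT) //=; apply: eq_bigr => b _.
  by rewrite -sum1_card; apply: eq_bigl => x; rewrite inE.
move=> EE; have {}no b : #|B| * #|[set x in E | f x == b]|%SET < #|E|.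
  by rewrite ltnNge; apply/negP; exact: no.
have B0 : 0 < #|B| by apply/card_gt0P; exists (f x0).
have : \sum_(b : B) (#|B| * #|[set x in E | f x == b]|%SET) < \sum_(b : B) #|E|.
  apply: (@leq_trans (\sum_(b : B) (#|B| * #|[set x in E | f x == b]|%SET).+1)).
    under [leqRHS]eq_bigr do rewrite -addn1.
    rewrite big_split /= sum_nat_const muln1 -ltn_subLR //.
    by rewrite ?subnn // leq_addr.
  by apply: leq_sum => b _; exact: no.
by rewrite -big_distrr /= -EE sum_nat_const ltnn.
Qed.

Variables D U : finType.

Definition mix (J : {set D}) (Y W : {ffun D -> U}) : {ffun D -> U} :=
  [ffun x => if x \in J then Y x else W x].

(** Exchanging the coordinates in [J] between [Y] and [W] is an involution of
    the pairs, so a pair mixes into [E] with the same probability as a single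
    tuple lies in [E]; averaging over [W] gives the claim. *)
Lemma mix_section (J : {set D}) (E : {set {ffun D -> U}}) :
  0 < #|E| -> exists W, #|E| <= #|[set Y | mix J Y W \in E]%SET|.
Proof.
move=> E0.
pose phi (YW : {ffun D -> U} * {ffun D -> U}) :=
  (mix J YW.1 YW.2, mix J YW.2 YW.1).
have phiK : involutive phi.
  move=> [Y W]; rewrite /phi /=; congr pair; apply/ffunP => x;
  by rewrite !ffunE; case: (x \in J).
pose G : {set {ffun D -> U} * {ffun D -> U}} := finset.setX E finset.setT.
have cG : #|phi @: G| = #|E| * #|{: {ffun D -> U}}|.
  by rewrite (card_imset _ (inv_inj phiK)) cardsX cardsT.
have N0 : 0 < #|{: {ffun D -> U}}|.
  exact: leq_trans E0 (max_card _).
have /(@large_fiber _ _ _ snd)[W] : 0 < #|phi @: G| by rewrite cG muln_gt0 E0.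
rewrite cG mulnC leq_pmul2l //.
move=> le; exists W; apply: (leq_trans le).
rewrite -(@card_in_imset _ _ fst); last first.
  by move=> [x y] [x' y']; rewrite !inE /= => /andP[_ /eqP->] /andP[_ /eqP->] ->.
apply: subset_leq_card; apply/fintype.subsetP => Y /imsetP[[Y' W']].
rewrite !inE => /andP[/imsetP[[A B]]]; rewrite !inE andbT /= => AE [-> ->].
move=> /eqP <- ->; rewrite -[_ \in E]/((mix J (mix J A B) (mix J B A)) \in E).
by have := phiK (A, B); rewrite /phi /= => -[-> _].
Qed.

(** A coordinate of a uniform tuple is uniform: swapping [u] with the
    coordinate [d] of [Y] is injective on pairs [(Y, u)]. *)
Lemma count_coordinate (d : D) (P : pred U) :
  #|[set Y : {ffun D -> U} | P (Y d)]%SET| * #|U| <=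
  #|[set u | P u]%SET| * #|{: {ffun D -> U}}|.
Proof.
rewrite -!cardsT -!cardsX.
pose psi (Yu : {ffun D -> U} * U) :=
  (Yu.1 d, [ffun x => if x == d then Yu.2 else Yu.1 x] : {ffun D -> U}).
rewrite -(@card_in_imset _ _ psi); last first.
  move=> [Y u] [Y' u'] _ _ e.
  have /= ed := congr1 fst e; have /= /ffunP ex := congr1 snd e.
  have -> : u = u' by have := ex d; rewrite !ffunE eqxx.
  suff -> : Y = Y' by [].
  apply/ffunP => x; have := ex x; rewrite !ffunE.
  by have [->|] := eqVneq x d.
apply: subset_leq_card; apply/fintype.subsetP => Z /imsetP[[Y u] + ->].
by rewrite !inE /= !andbT.
Qed.

End Counting.

(** * Multiplicative weights *)

Section Weights.
Local Open Scope nat_scope.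

Lemma bernoulli_expn (a n : nat) : a ^ n * (a + n) <= a * (a.+1) ^ n.
Proof.
elim: n => [|n IHn]; first by rewrite !expn0 addn0 mul1n muln1.
rewrite [leqRHS](_ : _ = a.+1 * (a * a.+1 ^ n)); last by rewrite expnS; lia.
apply: leq_trans (leq_mul (leqnn a.+1) IHn).
by rewrite expnS; nia.
Qed.

Lemma four_expn_le (a : nat) : 0 < a -> 4 * a ^ (2 * a) <= a.+1 ^ (2 * a).
Proof.
move=> a0; have := bernoulli_expn a a; rewrite addnn -muln2 mulnCA leq_pmul2l //.
by move=> le2; have := leq_mul le2 le2; rewrite !(mulnC 2) !expnM -!mulnn; nia.
Qed.

(** A form of linear programming duality: if every weighting of [I] is hit in
    a fraction [1 / M] by a single point, then a sequence of points hits each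
    [i] a fraction [1 / (4 * M)] of the time.  Halve the weight of [i] whenever
    it is hit, and always add a point that hits much weight: the total weight
    decays exponentially, hence so does each single weight, which is only
    possible if [i] is hit at a linear rate.  Multisets, encoded by
    maps [a] into [I], stand for integral weights. *)
Lemma multiplicative_weights (I : finType) (X : Type) (b : X -> I -> bool)
    (M : nat) (i0 : I) :
  0 < M ->
  (forall (U : finType) (a : U -> I), 0 < #|U| ->
     exists x, #|U| <= M * #|[set u | b x (a u)]%SET|) ->
  exists2 xs : seq X, 0 < size xs &
    forall i, size xs <= 4 * M * count (b^~ i) xs.
Proof.
move=> M0 popular.
have weighted (w : I -> nat) : 0 < \sum_i w i ->
    exists x, \sum_i w i <= M * \sum_(i | b x i) w i.
  have cardT (P : pred I) :
      #|[set u : {i : I & 'I_(w i)} | P (tag u)]%SET| = \sum_(i | P i) w i.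
    rewrite -sum1_card -[RHS](eq_bigr _ (fun i _ => card_ord (w i))).
    rewrite (eq_bigr (fun i => \sum_(j : 'I_(w i)) 1)); last first.
      by move=> i _; rewrite sum1_card.
    rewrite sig_big_dep /=; apply: eq_bigl => u.
    by rewrite inE andbT.
  have := cardT predT; rewrite (_ : [set _ | _]%SET = finset.setT); last first.
    by apply/setP => u; rewrite !inE.
  rewrite cardsT => cT W0.
  have [|x] := @popular {i : I & 'I_(w i)} (@tag _ _); first by rewrite cT.
  by rewrite cT cardT; exists x.
(* To keep the weights integral, they are scaled by 2 ^ (size xs). *)
pose phi xs := \sum_i 2 ^ (size xs - count (b^~ i) xs).
have step t : exists2 xs : seq X, size xs = t &
    M ^ t * phi xs <= (2 * M).-1 ^ t * #|I|.
  elim: t => [|t [xs sz IHt]].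
    exists [::] => //; rewrite !expn0 !mul1n /phi /=.
    by rewrite sum_nat_const muln1.
  have [|x le_x] := weighted (fun i => 2 ^ (size xs - count (b^~ i) xs)).
    by rewrite (bigD1 i0) //= addn_gt0 expn_gt0.
  exists (x :: xs); first by rewrite /= sz.
  have new : phi (x :: xs) +
      \sum_(i | b x i) 2 ^ (size xs - count (b^~ i) xs) = 2 * phi xs.
    rewrite /phi [X in _ + X]big_mkcond -big_split big_distrr /=.
    apply: eq_bigr => i _; have := count_size (b^~ i) xs.
    case: (b x i) => le_c; first by rewrite add1n subSS addnn -mul2n.
    by rewrite add0n addn0 subSn // expnS.
  rewrite -/(phi xs) in le_x.
  have key : M * phi (x :: xs) <= (2 * M).-1 * phi xs by nia.
  rewrite !expnSr; have := leq_mul (leqnn (M ^ t)) key.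
  by have := leq_mul (leqnn (2 * M).-1) IHt; nia.
(* In 2 * a steps the total weight decays by the factor (a / a.+1) ^ (2 * a),
   at most 1 / 4.  Decay by 4 ^ #|I| leaves 2 ^ #|I| after the initial total
   weight, #|I|, is absorbed. *)
set a := (2 * M).-1; have a0 : 0 < a by rewrite /a; lia.
have [xs sz le_phi] := step (2 * a * #|I|).
have I0 : 0 < #|I| by apply/card_gt0P; exists i0.
exists xs; first by rewrite sz !muln_gt0 a0.
move=> i; set c := count _ xs.
suff : #|I| <= c by rewrite sz /a; nia.
have le_i : 2 ^ (size xs - c) <= phi xs by rewrite /phi (bigD1 i) //= leq_addr.
have le_c : c <= size xs by exact: count_size.
have : a.+1 ^ (2 * a * #|I|) <= 2 ^ c * (a ^ (2 * a * #|I|) * #|I|).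
  rewrite (_ : a.+1 = 2 * M); last by rewrite /a; lia.
  rewrite expnMn mulnC -sz -{2}(subnK le_c) expnD [2 ^ _ * _]mulnC mulnCA.
  rewrite leq_mul2l expn_eq0 /=.
  rewrite -sz in le_phi; apply: leq_trans le_phi.
  by rewrite leq_mul2l le_i orbT.
have : 4 ^ #|I| * a ^ (2 * a * #|I|) <= a.+1 ^ (2 * a * #|I|).
  by rewrite !(expnM _ (2 * a)) -expnMn leq_exp2r // four_expn_le.
move=> le4 /(leq_trans le4); rewrite mulnCA mulnC.
rewrite leq_pmul2l ?expn_gt0 ?a0 // => le5.
rewrite -(@leq_exp2l 2) //.
have ltI : #|I| < 2 ^ #|I| by exact: ltn_expl.
rewrite -(leq_pmul2r I0); apply: leq_trans le5.
by rewrite -[4]/(2 * 2) expnMn leq_mul2l (ltnW ltI) orbT.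
Qed.

End Weights.

(** * Sets of k points of S *)

Section Points.
Local Open Scope nat_scope.
Variables (T : choiceType) (S : set T) (k : nat).

(** Finite sets of points are handled as duplicate-free sequences. *)
Definition kpoints (K : seq T) : Prop :=
  [/\ uniq K, size K = k & [set` K] `<=` S].

Lemma has_pointsP (A : set T) :
  has_points S k A <-> exists2 K, kpoints K & [set` K] `<=` A.
Proof.
rewrite /has_points; split.
  move=> /card_leP[f].
  pose g (i : 'I_k) : T := set_val (f (SigSub (mem_set (ltn_ord i : `I_k i)))).
  have gA i : (A `&` S) (g i) by exact: set_valP.
  exists (codom g); last by move=> x /codomP[i ->]; case: (gA i).
  split; [|by rewrite size_codom card_ord|by move=> x /codomP[i ->]; case: (gA i)].
  apply/injectiveP => i j /val_inj /(@inj _ _ _ f) e.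
  by apply: val_inj; have := e (in_setT _) (in_setT _) => -[].
move=> [K [uK sK KS] KA].
have : ([set` [fset x in K]] #= `I_k)%card.
  by apply/card_eq_fsetP; rewrite card_fseq undup_id.
move=> /card_eqPle[_ le]; apply: (card_le_trans le); apply: subset_card_le.
move=> x /=; rewrite !inE => xK; split; [exact: KA|exact: KS].
Qed.

Lemma sub_has_points (A B : set T) :
  A `<=` B -> has_points S k A -> has_points S k B.
Proof.
by move=> AB /has_pointsP[K Kk KA]; apply/has_pointsP; exists K => // x /KA/AB.
Qed.

Lemma has_points_count (X C : set T) (Q : seq T) :
  uniq Q -> C `&` S = [set` Q] ->
  has_points S k (X `&` C) <-> k <= count (mem X) Q.
Proof.
move=> uQ CQ; split.
  move=> /has_pointsP[K [uK <- KS] KXC].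
  rewrite -size_filter; apply: uniq_leq_size => // x xK.
  have [Xx Cx] := KXC _ xK; rewrite mem_filter /= mem_set //=.
  by have : [set` Q] x by rewrite -CQ; split=> //; exact: KS.
move=> kc; apply/has_pointsP; exists (take k (seq.filter (mem X) Q)).
  split; first by rewrite take_uniq // filter_uniq.
    by rewrite size_take size_filter; case: ltnP => // ck; apply/eqP; rewrite eqn_leq ck.
  move=> x /mem_take; rewrite mem_filter => /andP[_ xQ].
  by have : [set` Q] x by []; rewrite -CQ => -[].
move=> x /mem_take; rewrite mem_filter => /andP[/= /set_mem Xx xQ].
by split=> //; have : [set` Q] x by []; rewrite -CQ => -[].
Qed.

End Points.

(** * The first k points of an intersection *)

Section Helly.
Local Open Scope nat_scope.
Variables (T : choiceType) (S : set T) (k : nat).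
Variables (cvx : set T -> Prop) (h : nat).

Definition meet (A : 'I_h -> set T) : set T := \bigcap_i A i.
Definition meet_but (j : 'I_h) (A : 'I_h -> set T) : set T :=
  \bigcap_(i in [set i | i != j]) A i.

(** The form in which Helly's property is applied: to [h] sets of which the
    intersection has [k] points and to one more set [C].  When [C] destroys
    this, it does so already together with [h - 1] of them. *)
Definition cut_helly : Prop := forall (A : 'I_h -> set T) (C : set T),
  (forall i, cvx (A i)) -> cvx C ->
  has_points S k (meet A) ->
  (forall j, has_points S k (meet_but j A `&` C)) ->
  has_points S k (meet A `&` C).

(** The convex sets [C] stand for the halfspaces below a moving hyperplane; only
    their traces on [S] matter, so an enumeration of a part of [S] encodes the
    whole motion. *)
Definition sweep (P : seq T) : Prop :=
  uniq P /\ forall i, exists2 C, cvx C & C `&` S = [set` take i P].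

Definition first_points (P : seq T) (X : set T) : seq T :=
  take k (seq.filter (mem X) P).

Lemma sweep_sub P : sweep P -> [set` P] `<=` S.
Proof.
by move=> [_ /(_ (size P))[C _]]; rewrite take_size => <- x [].
Qed.

Lemma first_points_sub P X : [set` first_points P X] `<=` X.
Proof. by move=> x /mem_take; rewrite mem_filter => /andP[/= /set_mem]. Qed.

Lemma kpoints_first P X : sweep P -> k <= count (mem X) P ->
  kpoints S k (first_points P X).
Proof.
move=> sP kc; split.
- by rewrite take_uniq // filter_uniq //; case: sP.
- by rewrite size_take size_filter; case: ltnP => // ck; apply/eqP; rewrite eqn_leq ck.
- by move=> x /mem_take; rewrite mem_filter => /andP[_]; exact: sweep_sub.
Qed.

(** Stop the sweep just before the [k]-th point [s] of the intersection.  The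
    convex set [C] that realizes this leaves [k - 1] points, so by Helly's
    property it also leaves less than [k] points in the intersection that omits
    some [A j].  The latter is larger, so these are the same [k - 1] points,
    and [s] is the next one for both. *)
Lemma first_points_determined P (A : 'I_h -> set T) :
  cut_helly -> 0 < h -> (forall i, cvx (A i)) -> sweep P ->
  k <= count (mem (meet A)) P ->
  exists j, first_points P (meet A) = first_points P (meet_but j A).
Proof.
move=> helly h0 cA sP kc; have [uP swP] := sP.
have [k0|k0] := posnP k.
  by exists (Ordinal h0); rewrite /first_points k0 !take0.
set X := meet A.
have ex : exists i, k <= count (mem X) (take i P).
  by exists (size P); rewrite take_size.
case: (ex_minnP ex) => -[|i]; first by rewrite take0 /= leqNgt k0.
move=> ki min_i.
have lt_i : count (mem X) (take i P) < k.
  by rewrite ltnNge; apply/negP => /min_i; rewrite ltnn.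
have iP : i < size P.
  rewrite ltnNge; apply/negP => Pi; move: ki lt_i.
  by rewrite !take_oversize ?ltnNge ?(leqW Pi) // => ->.
have [s Ps] : exists s, take i.+1 P = rcons (take i P) s.
  case: P iP {kc sP uP swP ex ki min_i lt_i} => // x0 P iP.
  by exists (nth x0 (x0 :: P) i); rewrite (take_nth x0).
have Xs : s \in mem X.
  apply: contraLR lt_i => Xs; rewrite -leqNgt; apply: leq_trans ki _.
  by rewrite Ps -cats1 count_cat /= (negbTE Xs) !addn0.
have [C cC CS] := swP i.
have uPi : uniq (take i P) by rewrite take_uniq.
have noX : ~ has_points S k (X `&` C).
  by move=> /(has_points_count _ _ uPi CS); rewrite leqNgt lt_i.
have [j noXj] : exists j, ~ has_points S k (meet_but j A `&` C).
  apply: contrapT => /forallNP all_j; apply: noX; apply: helly => //.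
    apply/has_pointsP; exists (first_points P X); first exact: kpoints_first.
    exact: first_points_sub.
  by move=> j; apply: contrapT; exact: all_j.
exists j; set Y := meet_but j A.
have XY : X `<=` Y by move=> x Xx i0 _; exact: Xx.
have XYm x : x \in X -> x \in Y by move=> /set_mem /XY /mem_set.
have lt_iY : count (mem Y) (take i P) < k.
  by rewrite ltnNge; apply/negP => /(has_points_count _ _ uPi CS).
have eq_i : seq.filter (mem X) (take i P) = seq.filter (mem Y) (take i P).
  have sub : subseq (seq.filter (mem X) (take i P)) (seq.filter (mem Y) (take i P)).
    rewrite (_ : seq.filter (mem X) _ = seq.filter (mem X) (seq.filter (mem Y) (take i P))).
      exact: filter_subseq.
    rewrite -filter_predI; apply: eq_filter => x /=.
    by case: (boolP (x \in X)) => // /XYm ->.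
  apply/eqP; rewrite -(size_subseq_leqif sub) !size_filter.
  rewrite eqn_leq; apply/andP; split.
    by have := size_subseq sub; rewrite !size_filter.
  rewrite -ltnS; apply: (leq_trans lt_iY); apply: leq_trans ki _.
  by rewrite Ps -cats1 count_cat /= Xs addn0 addn1.
have eq_i1 : seq.filter (mem X) (take i.+1 P) = seq.filter (mem Y) (take i.+1 P).
  have Ys : mem Y s by exact: XYm.
  by rewrite Ps !filter_rcons eq_i Ys (_ : mem X s).
have sz : size (seq.filter (mem X) (take i.+1 P)) = k.
  apply/eqP; rewrite eqn_leq size_filter ki andbT.
  by rewrite Ps -cats1 count_cat /= Xs addn0 addn1.
have cut Z : k = size (seq.filter (mem Z) (take i.+1 P)) ->
    first_points P Z = seq.filter (mem Z) (take i.+1 P).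
  move=> kZ; rewrite /first_points -{1}(cat_take_drop i.+1 P) filter_cat.
  by rewrite take_cat -kZ ltnn subnn take0 cats0.
by rewrite !cut // -eq_i1.
Qed.

End Helly.

(** * A colourful selection lemma *)

Section Selection.
Local Open Scope nat_scope.
Variables (T : choiceType) (S : set T) (k : nat).
Variables (cvx : set T -> Prop) (h : nat).
Hypothesis h_gt0 : 0 < h.
Hypothesis helly : cut_helly S k cvx h.
Hypothesis sweeps : forall Z : seq T, [set` Z] `<=` S ->
  exists2 P, sweep S cvx P & {subset Z <= P}.
Hypothesis cvx_bigcap : forall (I : Type) (E : set I) (F : I -> set T),
  (forall i, E i -> cvx (F i)) -> cvx (\bigcap_(i in E) F i).

Lemma exists_injection (X : finType) (G : {set X}) (n : nat) :
  n <= #|G| -> exists2 f : 'I_n -> X, injective f & forall j, f j \in G.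
Proof.
move=> nG; exists (fun j => enum_val (widen_ord nG j)).
  by move=> i j /enum_val_inj /(congr1 val) /= /val_inj.
by move=> j; exact: enum_valP.
Qed.

(** Every tuple [Y] has a pattern [c] for which the [h] sets [B c j Y] share
    [k] points, and the first [k] common points are determined without one of
    the indices, [j].  One pair [(c, j)] serves the fraction [1 / (#|Q| * h)]
    of the tuples.  For some choice [W] of the coordinates outside the block
    [J c j], at least this fraction remains when only the block varies, and
    then the first [k] points do not vary. *)
Lemma block_selection (D U Q : finType) (valid : pred Q)
    (J : Q -> 'I_h -> {set D}) (B : Q -> 'I_h -> {ffun D -> U} -> set T) :
  0 < #|{: {ffun D -> U}}| ->
  (forall c j Y, cvx (B c j Y)) ->
  (forall c j (Y Y' : {ffun D -> U}), valid c ->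
     {in J c j, Y =1 Y'} -> B c j Y = B c j Y') ->
  (forall c i j x, valid c -> x \in J c i -> x \in J c j -> i = j) ->
  (forall Y, exists2 c, valid c & has_points S k (meet (fun j => B c j Y))) ->
  exists c j K, [/\ valid c, kpoints S k K &
    #|{: {ffun D -> U}}| <=
      #|Q| * h * #|[set Y | `[< [set` K] `<=` B c j Y >]]%SET|].
Proof.
move=> N0 cB locB disjJ ptsB.
have /choice[w wP] : forall Y, exists cZ : Q * seq T,
    [/\ valid cZ.1, kpoints S k cZ.2 &
      [set` cZ.2] `<=` meet (fun j => B cZ.1 j Y)].
  by move=> Y; have [c vc /has_pointsP[Z kZ ZB]] := ptsB Y; exists (c, Z).
(* One list holds k common points for each of the finitely many tuples, so that
   the first k points mean the same for all of them. *)
have [|P sP ZP] := @sweeps (flatten [seq (w Y).2 | Y <- enum {: {ffun D -> U}}]).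
  move=> x /flatten_mapP[Y _ xY].
  by have [_ [_ _ ZS] _] := wP Y; exact: ZS.
pose A Y j := B (w Y).1 j Y.
have cntA Y : k <= count (mem (meet (A Y))) P.
  have [_ [uZ <- _] ZA] := wP Y; rewrite -size_filter; apply: uniq_leq_size => //.
  move=> x xZ; rewrite mem_filter /= mem_set /=; last exact: ZA.
  by apply: ZP; apply/flatten_mapP; exists Y; rewrite ?mem_enum.
have /choice[jf jfP] Y := first_points_determined helly h_gt0
  (fun j => cB (w Y).1 j Y) sP (cntA Y).
have /(@large_fiber _ _ _ (fun Y : {ffun D -> U} => ((w Y).1, jf Y)))[[c j]] :
  0 < #|[set: {ffun D -> U}]%SET| by rewrite cardsT.
rewrite cardsT card_prod card_ord; set E := [set _ in _ | _]%SET => leE.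
have E0 : 0 < #|E|.
  by have := leq_trans N0 leE; rewrite muln_gt0 => /andP[].
have vc : valid c.
  have /card_gt0P[Y] := E0; rewrite !inE => /eqP[<- _].
  by have [] := wP Y.
have [W leW] := mix_section (J c j) E0.
pose K := first_points k P (meet_but j (fun i => B c i W)).
have KE Y : mix (J c j) Y W \in E ->
    [/\ kpoints S k K & [set` K] `<=` B c j Y].
  set Y' := mix _ _ _; rewrite !inE => /eqP[cY' jY'].
  have KK : K = first_points k P (meet (A Y')).
    rewrite jfP jY' /K; congr first_points; rewrite /meet_but.
    apply: eq_bigcapr => i /= /eqP ij; rewrite /A cY'; apply: locB => // x xi.
    rewrite ffunE; case: ifP => // xj; case: ij; exact: disjJ vc xi xj.
  split; first by rewrite KK; exact: kpoints_first sP (cntA Y').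
  have <- : A Y' j = B c j Y.
    by rewrite /A cY'; apply: locB => // x xj; rewrite ffunE xj.
  by rewrite KK => x /first_points_sub; exact.
exists c, j, K; split=> //.
  have /card_gt0P[Y] : 0 < #|[set Y | mix (J c j) Y W \in E]%SET|.
    exact: leq_trans E0 leW.
  by rewrite inE => /KE[].
apply: (leq_trans leE); rewrite leq_mul2l; apply/orP; right.
apply: (leq_trans leW); apply: subset_leq_card; apply/fintype.subsetP => Y.
by rewrite inE => /KE[_ KB]; rewrite inE; apply/asboolP.
Qed.

(** Among [p * q] members with repetitions, either one occurs [h] times, or
    there are [p] different ones, and [q >= h] of these share [k] points.  So
    every tuple of length [p * q] has [h] positions for which the members
    share [k] points, and the selection lemma applies with one coordinate in
    each block. *)
Lemma fractional_helly (I : finType) (F : I -> set T) (p q : nat) :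
  0 < q -> h <= q ->
  (forall i, cvx (F i)) -> (forall i, has_points S k (F i)) ->
  (forall G : {set I}, #|G| = p -> exists G' : {set I},
    [/\ G' \subset G, #|G'| = q &
      has_points S k (\bigcap_(i in [set` G']) F i)]) ->
  forall (U : finType) (a : U -> I), 0 < #|U| ->
  exists2 K, kpoints S k K &
    #|U| <= #|{: {ffun 'I_h -> 'I_(p * q)}}| * h *
      #|[set u | `[< [set` K] `<=` F (a u) >]]%SET|.
Proof.
move=> q0 hq cF ptsF pq U a U0.
pose D := 'I_(p * q).
have N0 : 0 < #|{: {ffun D -> U}}| by rewrite card_ffun expn_gt0 U0.
have [||||c [j [K [_ kK le]]]] := @block_selection D U {ffun 'I_h -> D}
  (fun c => injectiveb c)
  (fun c j => [set c j]%SET) (fun c j Y => F (a (Y (c j)))) N0.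
- by move=> c j Y; exact: cF.
- by move=> c j Y Y' _ eY; rewrite eY // inE.
- move=> c i j x /injectiveP inj_c; rewrite !inE => /eqP -> /eqP; exact: inj_c.
- move=> Y; pose b d := a (Y d).
  have [[i hi]|small] := pselect (exists i, h <= #|[set d | b d == i]%SET|).
    have [f inj_f fi] := exists_injection hi.
    exists [ffun j => f j].
      by apply/injectiveP => j j'; rewrite !ffunE => /inj_f.
    apply: sub_has_points (ptsF i) => x Fx j _ /=; rewrite ffunE.
    by have := fi j; rewrite inE => /eqP; rewrite /b => ->.
  have big_image : p <= #|b @: [set: D]%SET|.
    rewrite -(leq_pmul2r q0) -{1}(card_ord (p * q)) -cardsT.
    rewrite -sum1_card (partition_big_imset b) /=.
    rewrite -[leqRHS]sum_nat_const; apply: leq_sum => i _.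
    apply: leq_trans hq; rewrite leqNgt; apply/negP => hi; apply: small; exists i.
    apply: ltnW; apply: leq_trans hi _; rewrite -sum1_card.
    by apply: eq_leq; apply: eq_bigl => d; rewrite !inE.
  have [g inj_g gb] := exists_injection big_image.
  have [|G' [G'G cG' ptsG']] := pq [set g j | j : 'I_p]%SET.
    by rewrite card_imset // card_ord.
  rewrite -cG' in hq; have [f inj_f fG'] := exists_injection hq.
  have /choice[c cP] : forall j, exists d, b d = f j.
    move=> j; have /(fintype.subsetP G'G) /imsetP[r _ ->] := fG' j.
    by have /imsetP[d _ ->] := gb r; exists d.
  exists [ffun j => c j].
    apply/injectiveP => i j; rewrite !ffunE => cij.
    by apply: inj_f; rewrite -!cP cij.
  apply: sub_has_points ptsG' => x xG' j _ /=; rewrite ffunE -/(b _) cP.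
  by apply: xG'; exact: fG'.
- exists K => //; rewrite -(leq_pmul2r N0) [leqLHS]mulnC.
  apply: (leq_trans (leq_mul le (leqnn #|U|))); rewrite -!mulnA.
  rewrite !leq_mul2l; apply/orP; right; apply/orP; right.
  exact: (@count_coordinate D U (c j) (fun u => `[< [set` K] `<=` F (a u) >])).
Qed.

(** * Tverberg's theorem on a grid and weak nets *)

Definition hull (Z : set T) : set T :=
  \bigcap_(C in [set C | cvx C /\ Z `<=` C]) C.

Lemma cvx_hull Z : cvx (hull Z).
Proof. by apply: cvx_bigcap => C []. Qed.

Lemma sub_hull Z : Z `<=` hull Z.
Proof. by move=> x Zx C [_]; exact. Qed.

Lemma hull_min Z C : cvx C -> Z `<=` C -> hull Z `<=` C.
Proof. by move=> cC ZC x; apply. Qed.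

Lemma hull_mono Z Z' : Z `<=` Z' -> hull Z `<=` hull Z'.
Proof.
by move=> ZZ'; apply: hull_min (@cvx_hull _) (subset_trans ZZ' (@sub_hull _)).
Qed.

Local Notation grid := {ffun 'I_h -> 'I_(h * h)}.

Definition slab (i : 'I_h) (c : 'I_(h * h)) : {set grid} :=
  [set x : grid | x i == c]%SET.

Definition slab_hull (y : grid -> seq T) i c : set T :=
  hull (\bigcup_(x in [set` slab i c]) [set` y x]).

(** One slab from each of the [h] directions always leaves the grid point with
    the chosen coordinates, so all tuples of slabs have intersecting hulls.
    The selection lemma finds a direction with a fraction [1 / h] of its
    [h * h] parallel slabs, that is [h] of them, sharing [k] points in their
    hulls.  Parallel slabs are disjoint. *)
Lemma slab_tverberg (y : grid -> seq T) :
  (forall x, kpoints S k (y x)) ->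
  exists i (c : {ffun 'I_h -> 'I_(h * h)}), injectiveb c /\
    has_points S k (meet (fun j => slab_hull y i (c j))).
Proof.
move=> ky.
have N0 : 0 < #|{: {ffun 'I_h -> 'I_(h * h)}}|.
  by rewrite card_ffun !card_ord expn_gt0 muln_gt0 h_gt0.
have [||||_ [i [K [_ kK le]]]] := @block_selection 'I_h 'I_(h * h) unit xpredT
  (fun _ j => [set j]%SET) (fun _ j Y => slab_hull y j (Y j)) N0.
- by move=> _ j Y; exact: cvx_hull.
- by move=> _ j Y Y' _ eY; rewrite eY // inE.
- by move=> _ i j x _; rewrite !inE => /eqP -> /eqP.
- move=> Y; exists tt => //; apply/has_pointsP; exists (y Y) => //.
  move=> x xY j _; apply: sub_hull; exists Y => //=; by rewrite inE.
- pose good c := `[< [set` K] `<=` slab_hull y i c >].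
  have [c inj_c c_good] : exists2 c : 'I_h -> 'I_(h * h), injective c &
      forall j, c j \in [set c | good c]%SET.
    apply: exists_injection.
    rewrite -(leq_pmul2l h_gt0) -(leq_pmul2r N0).
    have := @count_coordinate 'I_h _ i good; rewrite card_ord => le2.
    have := leq_mul le (leqnn (h * h)); rewrite card_unit mul1n => le1.
    rewrite mulnC; apply: leq_trans le1 _; rewrite -!mulnA leq_mul2l le2.
    by rewrite orbT.
  exists i, [ffun j => c j]; split.
    by apply/injectiveP => j j'; rewrite !ffunE => /inj_c.
  apply/has_pointsP; exists K => // x Kx j _ /=; rewrite ffunE.
  by have := c_good j; rewrite inE => /asboolP; exact.
Qed.

Definition net_const : nat :=
  #|{: 'I_h * {ffun 'I_h -> 'I_(h * h)}}| * h.

Definition tuple_hull (V : finType) (ks : V -> seq T) (Y : {ffun grid -> V}) :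
  set T :=
  hull (\bigcup_x [set` ks (Y x)]).

(** The disjoint slabs found by [slab_tverberg] serve as blocks of coordinates
    of a tuple indexed by the grid; the position of these slabs, being one of
    boundedly many, is the pattern. *)
Lemma popular_hull_points (V : finType) (ks : V -> seq T) :
  0 < #|V| -> (forall v, kpoints S k (ks v)) ->
  exists2 K, kpoints S k K &
    #|{: {ffun grid -> V}}| <=
      net_const * #|[set Y | `[< [set` K] `<=` tuple_hull ks Y >]]%SET|.
Proof.
move=> V0 kks.
have N0 : 0 < #|{: {ffun grid -> V}}| by rewrite card_ffun expn_gt0 V0.
have [||||[i c] [j [K [_ kK le]]]] := @block_selection grid V
  ('I_h * {ffun 'I_h -> 'I_(h * h)})%type (fun ic => injectiveb ic.2)
  (fun ic j => slab ic.1 (ic.2 j))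
  (fun ic j Y => slab_hull (fun x => ks (Y x)) ic.1 (ic.2 j)) N0.
- by move=> ic j Y; exact: cvx_hull.
- move=> [i c] j Y Y' _ /= eY; congr hull; apply: eq_bigcupr => x /= xs.
  by rewrite eY.
- move=> [i c] j j' x /= /injectiveP inj_c; rewrite !inE => /eqP -> /eqP.
  exact: inj_c.
- move=> Y; have [i [c [inj_c ptsc]]] := slab_tverberg (fun x => kks (Y x)).
  by exists (i, c).
- exists K => //; apply: (leq_trans le); rewrite leq_mul2l; apply/orP; right.
  apply: subset_leq_card; apply/fintype.subsetP => Y; rewrite 2!finset.inE => /asboolW KY.
  apply: asboolT => z0 /KY; apply: hull_mono.
  by move=> z [x _ zx]; exists x.
Qed.

(** As long as some convex [A], containing a fraction [1 / m] of the list,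
    contains no chosen set, consider the tuples of list entries lying in [A]:
    their hulls lie in [A] too, so no such tuple has a chosen set in its hull.
    By [popular_hull_points] a new set lies in a fixed fraction of these hulls.
    Every step thus uses up a fixed fraction of all tuples, which bounds the
    number of steps. *)
Lemma weak_net (V : finType) (ks : V -> seq T) (m : nat) :
  0 < #|V| -> (forall v, kpoints S k (ks v)) ->
  exists L : seq (seq T), [/\ size L <= (m ^ #|{: grid}| * net_const).+1,
    (forall K, K \in L -> kpoints S k K) &
    forall A, cvx A -> #|V| <= m * #|[set v | `[< [set` ks v] `<=` A >]]%SET| ->
      exists2 K, K \in L & [set` K] `<=` A].
Proof.
move=> V0 kks; set M := m ^ #|{: grid}| * net_const.
(* The tuples that are not used up yet. *)
pose alive (L : seq (seq T)) := [set Y : {ffun grid -> V} |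
  `[< forall K, K \in L -> ~ [set` K] `<=` tuple_hull ks Y >]]%SET.
pose N := #|{: {ffun grid -> V}}|.
have N0 : 0 < N by rewrite /N card_ffun expn_gt0 V0.
have greedy j : exists L : seq (seq T), [/\ size L <= j,
    (forall K, K \in L -> kpoints S k K) &
    (forall A, cvx A -> #|V| <= m * #|[set v | `[< [set` ks v] `<=` A >]]%SET| ->
      exists2 K, K \in L & [set` K] `<=` A) \/
    #|alive L| * M + j * N <= M * N].
  elim: j => [|j [L [sL kL [nL|aL]]]].
  - exists [::]; split=> //; right; rewrite addn0 mulnC leq_mul2l.
    by rewrite (max_card _) orbT.
  - by exists L; split; [exact: leqW|exact: kL|left].
  have [nL|] := pselect (forall A, cvx A ->
      #|V| <= m * #|[set v | `[< [set` ks v] `<=` A >]]%SET| ->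
      exists2 K, K \in L & [set` K] `<=` A).
    by exists L; split; [exact: leqW|exact: kL|left].
  move=> /existsNP[A /not_implyP[cA /not_implyP[denseA missA]]].
  pose VA := {v : V | `[< [set` ks v] `<=` A >]}.
  have cVA : #|{: VA}| = #|[set v | `[< [set` ks v] `<=` A >]]%SET|.
    by rewrite card_sig; apply: eq_card => v; rewrite inE.
  have VA0 : 0 < #|{: VA}|.
    by rewrite cVA; have := leq_trans V0 denseA; rewrite muln_gt0 => /andP[].
  have [K kK leK] := @popular_hull_points VA (fun v => ks (val v)) VA0 (fun v => kks _).
  exists (K :: L); split; first by rewrite ltnS.
    by move=> K'; rewrite inE => /predU1P[->//|]; exact: kL.
  right; set G := [set _ | _]%SET in leK.
  pose emb (Y : {ffun grid -> VA}) : {ffun grid -> V} := [ffun x => val (Y x)].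
  have inj_emb : injective emb.
    move=> Y Y' /ffunP e; apply/ffunP => x; apply: val_inj.
    by have := e x; rewrite !ffunE.
  have hull_emb Y : tuple_hull ks (emb Y) = tuple_hull (fun v : VA => ks (val v)) Y.
    by congr hull; apply: eq_bigcupr => x _; rewrite ffunE.
  have hull_sub Y : tuple_hull ks (emb Y) `<=` A.
    apply: hull_min => // z [x _ /=]; rewrite ffunE.
    by have /asboolP := valP (Y x); apply.
  have : #|alive (K :: L)| + #|emb @: G| <= #|alive L|.
    rewrite -cardsUI [X in _ + X](_ : _ = 0); last first.
      apply/eqP; rewrite cards_eq0; apply/eqP/setP => Z; rewrite !inE.
      apply/negbTE/negP => /andP[/asboolP aZ /imsetP[Y]]; rewrite inE.
      move=> /asboolP KY ZY; apply: (aZ K); first by rewrite mem_head.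
      by rewrite ZY hull_emb.
    rewrite addn0; apply: subset_leq_card; apply/fintype.subsetP => Z; rewrite !inE.
    move=> /orP[/asboolP aZ|/imsetP[Y _ ->]]; apply/asboolP => K' K'L.
      by apply: aZ; rewrite inE K'L orbT.
    by move=> K'Y; apply: missA; exists K' => //; move=> z /K'Y /hull_sub.
  rewrite card_imset // => le_alive.
  have leN : N <= M * #|G|.
    rewrite /N card_ffun; rewrite -cVA in denseA.
    have := leK; rewrite card_ffun => leK'.
    rewrite /M -mulnA; apply: leq_trans (leq_mul (leqnn _) leK').
    have [->|g0] := posnP #|{: grid}|; first by rewrite !expn0.
    by rewrite -expnMn leq_exp2r.
  rewrite mulSn; apply: leq_trans aL; rewrite addnA leq_add2r.
  by apply: leq_trans (leq_mul le_alive (leqnn M)); rewrite mulnDl leq_add2l mulnC.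
(* After M.+1 steps more than all the tuples would have been used up. *)
have [L [sL kL [nL|]]] := greedy M.+1; first by exists L.
by rewrite mulSn addnA -[leqRHS]add0n leq_add2r leqNgt addn_gt0 N0 orbT.
Qed.

(** * The (p, q)-theorem for abstract convexities *)

Definition piercing_const (p q : nat) : nat :=
  ((4 * (#|{: {ffun 'I_h -> 'I_(p * q)}}| * h)) ^ #|{: grid}| * net_const).+1.

Theorem pq_convexity (I : finType) (F : I -> set T) (p q : nat) :
  0 < p -> 0 < q -> h <= q ->
  (forall i, cvx (F i)) -> (forall i, has_points S k (F i)) ->
  (forall G : {set I}, #|G| = p -> exists G' : {set I},
    [/\ G' \subset G, #|G'| = q &
      has_points S k (\bigcap_(i in [set` G']) F i)]) ->
  exists L : seq (seq T), [/\ size L <= piercing_const p q,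
    (forall K, K \in L -> kpoints S k K) &
    forall i, exists2 K, K \in L & [set` K] `<=` F i].
Proof.
move=> p0 q0 hq cF ptsF pq.
have [[i0]|noI] := pselect (inhabited I); last first.
  by exists [::]; split=> // i; case: noI.
have fh := fractional_helly q0 hq cF ptsF pq; set M := _ * h in fh.
have M0 : 0 < M.
  by rewrite /M card_ffun !card_ord !muln_gt0 expn_gt0 muln_gt0 p0 q0 h_gt0.
pose X := {K : seq T | `[< kpoints S k K >]}.
have [|xs xs0 dense] := @multiplicative_weights I X
    (fun K i => `[< [set` val K] `<=` F i >]) M i0 M0.
  move=> U a U0; have [K kK le] := fh U a U0.
  by exists (exist _ K (asboolT kK)).
pose ks (v : 'I_(size xs)) : seq T := val (tnth (in_tuple xs) v).
have [||L [sL kL hit]] := @weak_net 'I_(size xs) ks (4 * M).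
- by rewrite card_ord.
- by move=> v; have /asboolP := valP (tnth (in_tuple xs) v).
exists L; split=> // i; apply: hit => //; rewrite card_ord.
apply: leq_trans (dense i) _; rewrite leq_mul2l; apply/orP; right.
rewrite -sum1_count big_tnth /= -sum1_card; apply: eq_leq; apply: eq_bigl => v.
by rewrite finset.inE.
Qed.

End Selection.

(** * Sweeping a discrete set by convex sets *)

Section Geometry.
Import Order.TTheory GRing.Theory Num.Theory.
Variables (R : realType) (d : nat).
Local Notation V := 'rV[R]_d.
Local Notation cvx := (@convex_set R V).

Lemma convex_set_bigcap (I : Type) (E : set I) (F : I -> set V) :
  (forall i, E i -> cvx (F i)) -> cvx (\bigcap_(i in E) F i).
Proof.
move=> cF x y t /set_mem Fx /set_mem Fy; apply/mem_set => i Ei.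
by apply/set_mem/cF => //; apply/mem_set; [exact: Fx|exact: Fy].
Qed.

Lemma convex_setI (A B : set V) : cvx A -> cvx B -> cvx (A `&` B).
Proof.
move=> cA cB x y t /set_mem[Ax Bx] /set_mem[Ay By]; apply/mem_set; split.
  by apply/set_mem/cA; exact/mem_set.
by apply/set_mem/cB; exact/mem_set.
Qed.

Definition dot (u x : V) : R := \sum_i u 0 i * x 0 i.

Lemma dotDr u a b (x y : V) : dot u (a *: x + b *: y) = a * dot u x + b * dot u y.
Proof.
rewrite /dot !mulr_sumr -big_split /=; apply: eq_bigr => i _.
by rewrite !mxE; ring.
Qed.

Lemma convex_combination (A : set V) :
  (forall (x y : V) (a b : R), 0 <= a -> 0 <= b -> a + b = 1 -> A x -> A y ->
     A (a *: x + b *: y)) -> cvx A.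
Proof.
move=> cA x y t /set_mem Ax /set_mem Ay; apply/mem_set.
apply: (cA x y t%:num (1 - t%:num)) => //.
by rewrite addrC subrK.
Qed.

Lemma convex_halfspace (u : V) (r : R) : cvx [set x | dot u x < r].
Proof.
apply: convex_combination => x y a b a0 b0 ab /= xr yr; rewrite dotDr.
have -> : r = a * r + b * r by rewrite -mulrDl ab mul1r.
have [az|an0] := eqVneq a 0.
  by rewrite az !mul0r !add0r ltr_pM2l //; lra.
apply: ltr_leD; first by rewrite ltr_pM2l // lt_def an0.
by apply: ler_wpM2l => //; exact: ltW.
Qed.

Definition box (r : R) : set V := [set x | forall i, `[- r, r]%classic (x 0 i)].

Lemma convex_box r : cvx (box r).
Proof.
apply: convex_combination => x y a b a0 b0 ab xr yr i; rewrite !mxE /=.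
have := xr i; have := yr i; rewrite /= !in_itv /= => /andP[y1 y2] /andP[x1 x2].
by apply/andP; split; nra.
Qed.

Lemma exists_box (Z : seq V) : exists r, [set` Z] `<=` box r.
Proof.
exists (\sum_(z <- Z) \sum_i `|z 0 i|) => z /= zZ i; rewrite /= in_itv /= -ler_norml.
rewrite (big_rem z) //= (bigD1 i) //= -addrA lerDl.
by rewrite addr_ge0 ?sumr_ge0 // => w _; rewrite sumr_ge0.
Qed.

(** Each of the neighbourhoods provided by discreteness holds at most one point
    of [S], and finitely many of them cover the compact box. *)
Lemma discrete_finite_box (S : set V) r : discrete_subset S ->
  exists2 Q : seq V, uniq Q & box r `&` S = [set` Q].
Proof.
move=> dS.
have /choice[U UP] : forall x : V, exists U : set V,
    nbhs x U /\ U `&` S `<=` [set x] by move=> x; have [U ? ?] := dS x; exists U.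
have : compact (box r).
  by apply: (@rV_compact R d (fun=> `[- r, r]%classic)) => i; exact: segment_compact.
rewrite compact_cover => /(_ V setT (fun x => (U x)^°)) [||D _ cov].
- by move=> x _; exact: open_interior.
- by move=> x _; exists x => //; case: (UP x).
exists [seq x <- enum_fset D | x \in box r `&` S].
  by rewrite filter_uniq ?fset_uniq.
apply/seteqP; split => x.
  move=> xBS; rewrite /= mem_filter mem_set //=.
  have [y yD yx] := cov x (proj1 xBS).
  have -> // : x = y.
  by have [_] := UP y; apply; split; [exact: interior_subset yx|case: xBS].
by rewrite /= mem_filter => /andP[/set_mem].
Qed.

(** A point [v] at maximal Euclidean distance from the origin works: for any
    other [w] in [Q], [|w - v| ^ 2 > 0] gives
    [2 <v, w> < |v| ^ 2 + |w| ^ 2 <= 2 |v| ^ 2], so the open halfspace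
    [<v, x> < |v| ^ 2] contains [w] and not [v]. *)
Lemma separate_farthest (Q : seq V) : Q != [::] ->
  exists v C, [/\ v \in Q, cvx C, ~ C v & forall w, w \in Q -> w != v -> C w].
Proof.
move=> Q0.
have [v vQ vmax] : exists2 v, v \in Q & forall w, w \in Q -> dot w w <= dot v v.
  elim: Q Q0 => // x Q IH _; have [->|/IH[v vQ vmax]] := eqVneq Q [::].
    by exists x; rewrite ?mem_head // => w; rewrite inE => /eqP ->.
  have [le|lt] := lerP (dot x x) (dot v v).
    exists v; first by rewrite inE vQ orbT.
    by move=> w; rewrite inE => /predU1P[->//|/vmax].
  exists x; rewrite ?mem_head // => w; rewrite inE => /predU1P[->//|/vmax] le.
  by apply: le_trans le _; exact: ltW.
exists v, [set x | dot v x < dot v v]; split=> //=; first exact: convex_halfspace.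
  by rewrite ltxx.
move=> w /vmax le wv.
suff : 0 < dot (w - v) (w - v).
  have -> : dot (w - v) (w - v) = dot w w + dot v v - 2 * dot v w.
    rewrite /dot mulr_sumr -big_split /= -sumrB; apply: eq_bigr => i _.
    by rewrite !mxE; ring.
  by lra.
rewrite lt_def sumr_ge0 ?andbT; last by move=> i _; rewrite -expr2 sqr_ge0.
apply: contra wv => /eqP dot0; rewrite -subr_eq0; apply/eqP/rowP => i.
rewrite [RHS]mxE; apply/eqP; rewrite -sqrf_eq0 expr2.
move: dot0 => /eqP; rewrite psumr_eq0; last by move=> j _; rewrite -expr2 sqr_ge0.
by move/allP => /(_ i (mem_index_enum i)).
Qed.

(** The list is built from its end, by peeling off farthest points. *)
Lemma exists_sweep (S B : set V) (Q : seq V) : uniq Q -> cvx B ->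
  B `&` S = [set` Q] -> exists2 P, sweep S cvx P & P =i Q.
Proof.
have [n] := ubnP (size Q); elim: n Q B => // n IHn Q B; rewrite ltnS => sQ uQ cB eB.
have [Q0|Qn0] := eqVneq Q [::].
  exists [::]; last by move=> x; rewrite Q0.
  by split=> // i; exists B; rewrite // eB Q0; case: i.
have [v [C [vQ cC Cv CQ]]] := separate_farthest Qn0.
have eBC : B `&` C `&` S = [set` rem v Q].
  apply/seteqP; split=> x /=; rewrite mem_rem_uniq // inE.
    move=> [[Bx Cx] Sx]; apply/andP; split; first by apply: contra_notN Cv => /eqP <-.
    by have : [set` Q] x by rewrite -eB.
  move=> /andP[xv xQ]; have : [set` Q] x by [].
  by rewrite -eB => -[Bx Sx]; do !split => //; exact: CQ.
have [|P [uP sP] eP] := IHn _ _ _ (rem_uniq v uQ) (convex_setI cB cC) eBC.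
  by rewrite size_rem // ; case: (Q) Qn0 sQ.
have vP : v \notin P by rewrite eP mem_rem_uniq // inE eqxx.
exists (rcons P v); last first.
  move=> x; rewrite mem_rcons inE eP mem_rem_uniq // inE.
  by have [->|] := eqVneq x v.
split; first by rewrite rcons_uniq vP.
move=> i; have [iP|Pi] := leqP i (size P).
  by rewrite -cats1 takel_cat //; exact: sP.
exists B => //; rewrite take_oversize ?size_rcons // eB.
apply/seteqP; split => x /=; rewrite mem_rcons inE eP mem_rem_uniq // inE;
  by have [->|] := eqVneq x v.
Qed.

End Geometry.

(** * From families of sets to indexed families *)

(** Take a subfamily of at most [h] of the sets.  If [C] is not among them,
    their intersection contains [meet A].  Otherwise at most [h' - 1] of them
    differ from [C]; representing each of these by one index leaves some [j]
    unused, and their intersection contains [meet_but j A `&` C]. *)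
Lemma cut_helly_convex (R : realType) (d : nat) (S : set 'rV[R]_d)
    (k h h' : nat) :
  helly_property S k h -> (h <= h')%N -> (0 < h')%N ->
  cut_helly S k (@convex_set R 'rV[R]_d) h'.
Proof.
move=> helly hh' h'0 A C cA cC ptsA ptsAC.
pose F : {fset set 'rV[R]_d} := (C |` [fset A j | j in 'I_h'])%fset.
have FA B : B \in F -> B != C -> exists j, A j = B.
  by rewrite !inE => /predU1P[->|/imfsetP[j _ ->] _]; [rewrite eqxx|exists j].
have ptsF : has_points S k (fam_inter F).
  apply: helly => [B BF|G' G'F sG'].
    by have [->//|/(FA _ BF)[j <-]] := eqVneq B C.
  have [CG|CG] := boolP (C \in G'); last first.
    apply: sub_has_points ptsA => x Ax B /= BG.
    have BC : B != C by apply: contraNneq CG => <-.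
    by have [j <-] := FA _ (fsubsetP G'F _ BG) BC; exact: Ax.
  have /choice[g gP] : forall B, exists j, B \in G' -> B != C -> A j = B.
    move=> B; have [BG|_] := boolP (B \in G'); last by exists (Ordinal h'0).
    have [_|BC] := eqVneq B C; first by exists (Ordinal h'0).
    by have [j Aj] := FA _ (fsubsetP G'F _ BG) BC; exists j.
  pose J := [fset g B | B in (G' `\ C)%fset]%fset.
  have [j jJ] : exists j, j \notin J.
    apply: contrapT => /forallNP all_j.
    have : (h' <= #|` J|)%N.
      rewrite -[leqLHS](size_enum_ord h'); apply: uniq_leq_size; first exact: enum_uniq.
      by move=> j _; apply: contrapT => /negP; exact: all_j.
    rewrite leqNgt => /negP; apply; apply: leq_ltn_trans (leq_imfset_card _ _ _) _ => /=.
    by apply: leq_trans hh'; apply: leq_trans sG'; rewrite [leqRHS](cardfsD1 C) CG.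
  apply: sub_has_points (ptsAC j) => x [Ax Cx] B /= BG.
  have [->//|BC] := eqVneq B C.
  rewrite -(gP B BG BC); apply: Ax => /=; apply: contraNneq jJ => <-.
  by apply/imfsetP; exists B; rewrite //= !inE BC.
apply: sub_has_points ptsF => x Fx; split; last by apply: Fx; rewrite /= fset1U1.
by move=> j _; apply: Fx; rewrite /= !inE; apply/orP; right; apply/imfsetP; exists j.
Qed.

Lemma card_fset_val (X : choiceType) (F : {fset X}) (G : {set F}) :
  #|` [fset val x | x in G]| = #|G|.
Proof.
by rewrite (card_imfset _ _ val_inj) -cardE.
Qed.

Theorem corollary1p2 (R : realType) (d : nat) (S : set 'rV[R]_d)
    (S_discrete : discrete_subset S) (k h : nat)
    (h_helly : is_quantitative_helly_number S k h)
    (p q : nat) (p_gt0 : (0 < p)%N) (q_gt0 : (0 < q)%N)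
    (le_qp : (q <= p)%N) (le_hq : (h <= q)%N) :
  exists c : nat,
    forall F : {fset set 'rV[R]_d},
      convex_family F ->
      (forall A : set 'rV[R]_d, A \in F -> has_points S k A) ->
      (forall G : {fset set 'rV[R]_d}, (G `<=` F)%fset -> #|` G| = p ->
         exists G' : {fset set 'rV[R]_d},
           [/\ (G' `<=` G)%fset, #|` G'| = q & has_points S k (fam_inter G')]) ->
      exists K : 'I_c -> set 'rV[R]_d,
        (forall i : 'I_c, has_points S k (K i)) /\
        (forall A : set 'rV[R]_d, A \in F -> exists i : 'I_c, K i `<=` A).
Proof.
(* If S has fewer than k points, the family is empty and so may be the piercing
   family; otherwise the whole space can pad the latter to its fixed size. *)
have [ptsT|noT] := pselect (has_points S k setT); last first.
  exists 0%N => F _ ptsF _; exists (fun=> setT); split=> [[]//|A AF].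
  by case: noT; apply: sub_has_points (ptsF A AF).
(* The grid needs a positive side and dimension, which h = 0 would not give. *)
pose h' := maxn h 1; have h'0 : (0 < h')%N by rewrite leq_max orbT.
have h'q : (h' <= q)%N by rewrite geq_max le_hq.
have helly := cut_helly_convex (proj1 h_helly) (leq_maxl h 1) h'0.
have sweeps (Z : seq 'rV[R]_d) : [set` Z] `<=` S ->
    exists2 P, sweep S (@convex_set R 'rV[R]_d) P & {subset Z <= P}.
  move=> ZS; have [r Zr] := exists_box Z.
  have [Q uQ eQ] := discrete_finite_box r S_discrete.
  have [P sP QP] := exists_sweep uQ (@convex_box _ _ r) eQ.
  exists P => // z zZ; rewrite QP.
  suff : [set` Q] z by [].
  by rewrite -eQ; split; [exact: Zr|exact: ZS].
exists (piercing_const h' p q) => F cF ptsF pq.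
have [||G cG|L [sL kL hit]] := pq_convexity h'0 helly sweeps
  (@convex_set_bigcap R d) (F := fun A : F => val A) p_gt0 q_gt0 h'q.
- by move=> A; exact/cF/valP.
- by move=> A; exact/ptsF/valP.
- have [||G' [G'G cG' ptsG']] := pq [fset val x | x in G].
  + by apply/fsubsetP => _ /imfsetP[A _ ->]; exact: valP.
  + by rewrite card_fset_val.
  pose H : {set F} := [set x | val x \in G']%SET.
  have HG' : [fset val x | x in H] = G'.
    apply/fsetP => B; apply/imfsetP/idP => [[A /= +->]|BG']; first by rewrite inE.
    have /imfsetP[A _ BA] := fsubsetP G'G _ BG'.
    by exists A => //=; rewrite inE -BA.
  exists H; split.
  + apply/fintype.subsetP => A; rewrite inE => /(fsubsetP G'G) /imfsetP[A' /= A'G].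
    by move=> /val_inj ->.
  + by rewrite -cG' -HG' card_fset_val.
  + apply: sub_has_points ptsG' => x xG' A /= AH; apply: xG' => /=.
    by move: AH; rewrite inE.
- have kset K : K \in L -> has_points S k [set` K].
    by move=> KL; apply/has_pointsP; exists K => //; exact: kL.
  exists (fun i => if (i < size L)%N then [set` nth [::] L i] else setT); split.
    by move=> i; case: ifP => // iL; apply/kset/mem_nth.
  move=> A AF; have [K KL KA] := hit [` AF].
  have iL : (index K L < size L)%N by rewrite index_mem.
  by exists (Ordinal (leq_trans iL sL)); rewrite /= iL nth_index.
Qed.
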